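(* Let $n\ge 1$ and let $\mathcal{H}$ be an $n$-uniform linear hypergraph with exactly $n$ hyperedges $F_1,\dots,F_n$. Then, for any choice of the identifier spanning trees, the auxiliary graph of the first kind $G_1(\mathcal{H})$ admits a Vandermonde-completable orientation of its identifier edges.
   Context: A hypergraph is linear if any two distinct edges share at most one vertex; for $v\in V(\mathcal{H})$, $d(v)$ is the number of edges containing $v$. The auxiliary graph of the first kind $G_1(\mathcal{H})$ is the multigraph built as follows. For each $i=1,\dots,n$ take a copy $K_n^{(i)}$ of the complete graph $K_n$ (the $i$-th base clique) with vertices $v_{i,1},\dots,v_{i,n}$, whose vertices are labelled bijectively by the $n$ vertices of $F_i$; the base cliques are vertex-disjoint, so each $v\in V(\mathcal{H})$ labels exactly $d(v)$ vertices of $G_1(\mathcal{H})$. For each $v\in V(\mathcal{H})$ choose an arbitrary spanning tree (an identifier spanning tree) on the set of the $d(v)$ vertices labelled by $v$. For each edge of each identifier spanning tree, $G_1(\mathcal{H})$ contains $n-1$ parallel edges between its two endpoints; these are the identifier edges. The edge set of $G_1(\mathcal{H})$ consists of the edges of the base cliques together with the identifier edges. An orientation of the identifier edges is called Vandermonde-completable if the edges of the base cliques can be oriented so that each base clique becomes a transitive tournament and every vertex of the whole graph $G_1(\mathcal{H})$ has in-degree at most $n-1$. *)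

(* Defs.v *)
From mathcomp Require Import all_boot.

Set Implicit Arguments.
Unset Strict Implicit.
Unset Printing Implicit Defensive.

(* A hypergraph on the finite vertex set V is given by its edge set. *)

Definition uniform_hypergraph (V : finType) (n : nat) (H : {set {set V}}) : Prop :=
  forall e, e \in H -> #|e| = n.

Definition linear_hypergraph (V : finType) (H : {set {set V}}) : Prop :=
  forall e f, e \in H -> f \in H -> e != f -> #|e :&: f| <= 1.

Definition adj (W : finType) (E : {set {set W}}) : rel W :=
  fun x y => (x != y) && ([set x; y] \in E).

(* E is the edge set of a tree with vertex set S. A cyclic sequence of at most
   two vertices is not a graph cycle (it backtracks along a single edge), hence
   the bound 2. The empty graph is accepted when S is empty. *)
Definition spanning_tree (W : finType) (S : {set W}) (E : {set {set W}}) : Prop :=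
  [/\ forall e, e \in E -> #|e| = 2 /\ e \subset S,
      {in S &, forall x y, connect (adj E) x y}
    & forall c : seq W, ucycle (adj E) c -> size c <= 2].

(* r restricted to S is the arc relation of a transitive tournament *)
Definition transitive_tournament (W : finType) (S : {set W}) (r : rel W) : Prop :=
  [/\ {in S, forall x, ~~ r x x},
      {in S &, forall x y, x != y -> r x y (+) r y x}
    & {in S & &, forall x y z, r x y -> r y z -> r x z}].

(* Parallel edges are distinct elements of the edge type with the same ends. *)
Record multigraph : Type := Multigraph {
  mvertex : finType;
  medge : finType;
  ends : medge -> {set mvertex} }.

(* An orientation is represented by the function giving the head of each edge. *)
Definition orientation (G : multigraph) (o : medge G -> mvertex G) : Prop :=
  forall e, o e \in ends e.

Definition indegree (G : multigraph) (o : medge G -> mvertex G)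
  (x : mvertex G) : nat := #|[set e | o e == x]|.

(* (i, j) stands for the vertex v_{i,j} of the i-th base clique. *)
Definition G1vertex (n : nat) : finType := ('I_n * 'I_n)%type.

Definition base_clique (n : nat) (i : 'I_n) : {set G1vertex n} :=
  [set x | x.1 == i].

(* The label of v_{i,j} is lab (i, j). *)
Definition labelling (V : finType) (n : nat) (F : 'I_n -> {set V})
  (lab : G1vertex n -> V) : Prop :=
  forall i, {in base_clique i &, injective lab} /\ lab @: base_clique i = F i.

Definition identifier_trees (V : finType) (n : nat) (lab : G1vertex n -> V)
  (T : V -> {set {set G1vertex n}}) : Prop :=
  forall v, spanning_tree [set x | lab x == v] (T v).

Definition base_edge (n : nat) : finType :=
  {e : {set G1vertex n} | (#|e| == 2) && [exists i, e \subset base_clique i]}.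

(* (v, e, k) is the k-th of the n - 1 copies of the edge e of the tree T v. *)
Definition identifier_edge (V : finType) (n : nat)
  (T : V -> {set {set G1vertex n}}) : finType :=
  {p : V * {set G1vertex n} * 'I_n.-1 | p.1.2 \in T p.1.1}.

Definition G1 (V : finType) (n : nat) (T : V -> {set {set G1vertex n}}) :
    multigraph :=
  @Multigraph (G1vertex n) (base_edge n + identifier_edge T)%type
    (fun e => match e with inl b => val b | inr p => (val p).1.2 end).

Definition identifier_orientation (V : finType) (n : nat)
  (T : V -> {set {set G1vertex n}}) (oI : identifier_edge T -> G1vertex n) :
    Prop :=
  forall p : identifier_edge T, oI p \in @ends (G1 T) (inr p).

(* under o, some base clique edge joining x and y is oriented from x to y *)
Definition base_arc (V : finType) (n : nat) (T : V -> {set {set G1vertex n}})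
  (o : medge (G1 T) -> mvertex (G1 T)) : rel (G1vertex n) :=
  fun x y => [exists b : base_edge n,
    (val b == [set x; y]) && (o (inl b) == y)].

Definition Vandermonde_completable (V : finType) (n : nat)
  (T : V -> {set {set G1vertex n}}) (oI : identifier_edge T -> G1vertex n) :
    Prop :=
  exists o : medge (G1 T) -> mvertex (G1 T),
    [/\ orientation o,
        forall p : identifier_edge T, o (inr p) = oI p,
        forall i : 'I_n, transitive_tournament (base_clique i) (base_arc o)
      & forall x : mvertex (G1 T), indegree o x <= n - 1].

(* Main.v *)
Require Import Defs.
From mathcomp Require Import all_boot.
From mathcomp Require Import zify.

(* Arrange the hyperedges on a cycle of length n and give a vertex of the i-th clique,
   labelled v, the distance (in 1, ..., n) from i to the next hyperedge containing v.
   For each v these distances sum to n. By linearity those below n are distinct within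
   a clique, so ordering each clique by distance gives a vertex at distance g
   in-degree at most g - 1. The vertices labelled v thus have base in-degrees summing
   to at most n - 1, which is the slack left by the (n - 1)(d(v) - 1) identifier edges
   of v, and a tree with such demands can be oriented leaf by leaf. *)

Set Implicit Arguments.
Unset Strict Implicit.
Unset Printing Implicit Defensive.

(** * Elementary counting *)

Lemma card_ord_lt N m : #|[pred k : 'I_N | k < m]| = minn m N.
Proof.
rewrite -sum1_card big_mkcond /=; elim: N => [|N IH]; first by rewrite big_ord0 minn0.
by rewrite big_ord_recr /= IH inE /=; case: ltnP; lia.
Qed.

Lemma card_ord_geq N m : #|[pred k : 'I_N | ~~ (k < m)]| = N - m.
Proof.
have /= := cardC [pred k : 'I_N | k < m]; rewrite card_ord_lt card_ord.
rewrite (@eq_card _ [predC _] [pred k : 'I_N | ~~ (k < m)]) //; lia.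
Qed.

Lemma card_pairs_dep (I J : finType) (P : pred I) (Q : I -> pred J) :
  #|[set p : I * J | P p.1 && Q p.1 p.2]| = \sum_(i | P i) #|Q i|.
Proof.
rewrite -sum1_card; under eq_bigl => p do rewrite inE.
rewrite -(pair_big_dep P Q (fun _ _ => 1)).
by apply: eq_bigr => i _; rewrite -sum1_card.
Qed.

Lemma cards2_mem (W : finType) (e : {set W}) x :
  #|e| = 2 -> x \in e -> exists2 y, y != x & e = [set y; x].
Proof.
move=> e2 xe; have /set0Pn[y] : e :\ x != set0.
  by rewrite -card_gt0; move: (cardsD1 x e); rewrite xe e2 => -[]; rewrite add0n => <-.
rewrite !inE => /andP[yx ye]; exists y => //.
apply/eqP; rewrite eq_sym eqEcard e2 cards2 yx andbT.
by apply/subsetP=> u; rewrite !inE => /orP[]/eqP->.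
Qed.

(** * Gaps between marked points on a cycle *)

(** [g i] is the number of steps from [i] to the next element of [D] around the cycle, possibly [i]
    itself after a full turn. The arcs of length [g i] starting at the points of [D] are disjoint,
    so their lengths add up to at most [n]. *)
Lemma cyclic_gaps n (D : {set 'I_n}) : exists g : 'I_n -> nat,
  (forall i, i \in D ->
     0 < g i <= n /\ exists2 j, j \in D & j = (i + g i) %% n :> nat)
  /\ \sum_(i in D) g i <= n.
Proof.
pose P (i : 'I_n) m := (0 < m) && [exists j in D, j == (i + m) %% n :> nat].
have gP i : exists g, i \in D -> [/\ P i g, g <= n & forall m, P i m -> g <= m].
  case: (boolP (i \in D)) => [iD|]; last by exists 0.
  (* A full turn leads back to [i], so a least positive distance exists and is at most [n]. *)
  have Pn : P i n.
    rewrite /P (leq_ltn_trans (leq0n i)) //=; apply/existsP; exists i.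
    by rewrite iD modnDr modn_small //= eqxx.
  have exP : exists m, P i m by exists n.
  by case: (ex_minnP exP) => g Pg gmin; exists g => _; split=> //; apply: gmin.
have [g {}gP] := fin_all_exists gP.
exists g; split=> [i /gP[/andP[-> /existsP[j /andP[jD /eqP jE]]] -> _]|].
  by split=> //; exists j.
pose A := [set p : 'I_n * 'I_n | (p.1 \in D) && (p.2 < g p.1)].
have lt_mod (i : 'I_n) m : (i + m) %% n < n.
  by rewrite ltn_mod (leq_ltn_trans (leq0n i)).
pose f (p : 'I_n * 'I_n) := Ordinal (lt_mod p.1 p.2).
have injf : {in A &, injective f}.
  (* If the arcs from [i] and [i'] meet at offsets [m <= m'], then [i] lies [m' - m] steps after
     [i'], fewer than [g i']. Minimality of [g i'] forces [m = m']. *)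
  have main (i i' m m' : 'I_n) : i \in D -> i' \in D -> m' < g i' -> m <= m' ->
      i + m = i' + m' %[mod n] -> (i, m) = (i', m').
    move=> iD i'D lt_m' le_m eqm.
    have {}eqm : i = (i' + (m' - m)) %% n :> nat.
      rewrite -[LHS](@modn_small _ n) //; apply/eqP.
      by rewrite -(eqn_modDr m) -addnA subnK // eqm.
    have [_ _ /(_ (m' - m))] := gP i' i'D; rewrite /P.
    have -> : [exists j in D, j == (i' + (m' - m)) %% n :> nat].
      by apply/existsP; exists i; rewrite iD -eqm eqxx.
    rewrite subn_gt0 andbT; case: ltngtP le_m => // [_ _ /(_ isT)|mm' _ _].
      by have := ltn_ord m; lia.
    move: eqm; rewrite mm' subnn addn0 modn_small // => /val_inj->.
    by congr pair; apply: val_inj.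
  move=> [i m] [i' m']; rewrite !inE /= => /andP[iD lt_m] /andP[i'D lt_m'].
  move/(congr1 val) => /= eqm.
  by case: (leqP m m') => [|/ltnW] le_m; [|symmetry]; apply: main.
have := leq_card_in f A injf; rewrite card_ord; congr (_ <= _).
rewrite (card_pairs_dep (mem D) (fun i => [pred m : 'I_n | m < g i])).
apply: eq_bigr => i /gP[_ gi _].
by rewrite card_ord_lt; apply/minn_idPl.
Qed.

(** * Orienting a tree with multiplied edges under vertex demands *)

(* The tree is grown one vertex at a time. A new leaf [x] with neighbour [p] keeps
   [N - b x] heads of its edge and hands the demand [b x] over to [p]. *)
Lemma spanning_tree_orientation (W : finType) (S : {set W}) (E : {set {set W}})
    (N : nat) (b : W -> nat) (x0 : W) :
  spanning_tree S E -> \sum_(x in S) b x <= N ->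
  exists h : {set W} -> 'I_N -> W,
    (forall e k, e \in E -> h e k \in e) /\
    {in S, forall x, \sum_(e in E) #|[pred k | h e k == x]| + b x <= N}.
Proof.
case=> EP connS acyc.
pose radj (A : {set W}) := [rel x y | [&& adj E x y, x \in A & y \in A]].
(* The demand is quantified inside [Q]: adding a leaf invokes the smaller tree with a different
   demand. *)
pose Q (A : {set W}) := forall b : W -> nat, \sum_(x in A) b x <= N ->
  exists h : {set W} -> 'I_N -> W,
    (forall e k, e \in E -> e \subset A -> h e k \in e) /\
    {in A, forall x,
      \sum_(e in E | e \subset A) #|[pred k | h e k == x]| + b x <= N}.
have adjC x y : adj E x y = adj E y x by rewrite /adj eq_sym setUC.
suff [A [AS cA _ QA]] : exists A : {set W},
    [/\ A \subset S, #|A| = #|S|, {in A &, forall x y, connect (radj A) x y} & Q A].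
  have {AS cA}AS : A = S by apply/eqP; rewrite eqEcard AS cA leqnn.
  move: QA; rewrite AS => /[apply] -[h [hP hN]].
  exists h; split=> [e k eE|x /hN]; first by apply: hP => //; case: (EP e eE).
  congr (_ + _ <= _); apply: eq_bigl => e.
  by case: (boolP (e \in E)) => // /EP[_ ->].
have [->|[r rS]] := set_0Vmem S.
  exists set0; split=> // [x y|c _]; first by rewrite inE.
  exists (fun _ _ => x0); split=> [e k /EP[e2 _]|x]; last by rewrite inE.
  by rewrite subset0 => /eqP e0; rewrite e0 cards0 in e2.
have: 0 < #|S| by rewrite card_gt0; apply/set0Pn; exists r.
have: #|S| <= #|S| by [].
elim: {1 3 4}#|S| => // -[|k] IH kS _.
  exists [set r]; split=> [||x y|c]; rewrite ?sub1set ?cards1 //.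
    by rewrite !inE => /eqP-> /eqP->; apply: connect0.
  rewrite big_set1 => cr; exists (fun _ _ => r).
  have no_edge e : e \in E -> e \subset [set r] = false.
    by move=> /EP[e2 _]; apply/negP => /subset_leq_card; rewrite e2 cards1.
  split=> [e j /no_edge->//|x]; rewrite inE => /eqP->.
  by rewrite big1 // => e /andP[/no_edge->].
have [A [AS cA connA QA]] := IH (ltnW kS) isT.
have /set0Pn[s sA] : A != set0 by rewrite -card_gt0 cA.
have [z zS zA] : exists2 z, z \in S & z \notin A.
  by apply/subsetPn; apply/negP => /subset_leq_card; rewrite cA leqNgt kS.
(* Some edge leaves [A]; otherwise [A] would be closed under adjacency, contradicting the
   connectedness of [S]. *)
have [p pA [x xA px]] : exists2 p, p \in A & exists2 x, x \notin A & adj E p x.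
  have [/exists_inP[p pA /exists_inP[x xA px]]|no] :=
    boolP [exists p in A, [exists x in ~: A, adj E p x]].
    by exists p => //; exists x => //; rewrite inE in xA.
  have cl : closed (adj E) A.
    apply: intro_closed => [|u v uv uA]; first exact/sym_connect_sym/adjC.
    apply: contraR no => vA; apply/exists_inP; exists u => //.
    by apply/exists_inP; exists v; rewrite ?inE.
  have := closed_connect cl (connS _ _ (subsetP AS _ sA) zS).
  by rewrite sA (negPf zA).
have xS : x \in S.
  by case/andP: px => _ /EP[_ /subsetP]; apply; rewrite !inE eqxx orbT.
(* A simple path inside [A] from a neighbour [y] of [x] to [p] closes up through [x]. Acyclicity
   bounds this closed sequence by two vertices, so the path is the single vertex [y = p]. *)
have uniq_p y : y \in A -> adj E y x -> y = p.
  move=> yA yx; have /connectP[q0 /shortenP[q pq uq _] pE] := connA _ _ yA pA.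
  have qA : {subset y :: q <= A}.
    move: yA pq; elim: (q) (y) => [|u q' IHq] v vA /=.
      by move=> _ w; rewrite inE => /eqP->.
    case/andP=> /and3P[_ _ uA] /(IHq u uA) sub w.
    by rewrite inE => /predU1P[->//|/sub].
  have : size (x :: y :: q) <= 2.
    apply: acyc; apply/andP; split; last first.
      by rewrite cons_uniq uq andbT; apply: contra xA => /qA.
    rewrite /= rcons_path -pE px adjC yx andbT /=.
    by apply: sub_path pq => u v /and3P[].
  by case: (q) pE.
have px_neq : x != p by apply: contraNneq xA => ->.
set e0 := [set p; x]; have e0E : e0 \in E by case/andP: px.
have new_edge e : e \in E -> (e \subset x |: A) = (e \subset A) || (e == e0).
  move=> eE; apply/idP/orP => [eA|[/subset_trans->//|/eqP->]]; last first.
  - by apply/subsetP=> u; rewrite !inE => /orP[]/eqP->; rewrite ?pA ?eqxx ?orbT.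
  - exact: subsetUr.
  have [xe|xe] := boolP (x \in e); [right|left]; last first.
    apply/subsetP=> u ue; move: (subsetP eA u ue).
    by rewrite !inE => /predU1P[ux|//]; rewrite -ux ue in xe.
  have [y yx eyx] := cards2_mem (EP e eE).1 xe.
  have ye : y \in e by rewrite eyx !inE eqxx.
  have yA : y \in A by have := subsetP eA y ye; rewrite !inE (negPf yx).
  by rewrite eyx (uniq_p y yA) // /adj yx -eyx.
have e0A : ~~ (e0 \subset A).
  by apply: contra xA => /subsetP; apply; rewrite !inE eqxx orbT.
exists (x |: A); split.
- by rewrite subUset sub1set xS.
- by rewrite cardsU1 xA cA.
- have sub : subrel (radj A) (radj (x |: A)).
    by move=> u v /and3P[uv uA vA]; rewrite /= uv !inE uA vA !orbT.
  have symr : connect_sym (radj (x |: A)).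
    by apply: sym_connect_sym => u v /=; rewrite adjC; do 2!case: (_ \in _ |: _).
  have toA u : u \in x |: A -> connect (radj (x |: A)) p u.
    rewrite inE in_set1 => /predU1P[->|uA].
      by apply: connect1; rewrite /= px !inE eqxx pA orbT.
    by apply: (connect_sub (e := radj A)) (connA _ _ pA uA) => v w /sub/connect1.
  by move=> u v /toA; rewrite symr => up /toA; apply: connect_trans.
move=> c sumc; rewrite big_setU1 //= in sumc.
have cN : c x <= N by apply: leq_trans (leq_addr _ _) sumc.
pose c' u := if u == p then c p + c x else c u.
have sumc' : \sum_(u in A) c' u = c x + \sum_(u in A) c u.
  rewrite (bigD1 p) //= [in RHS](bigD1 p) //= {1}/c' eqxx addnCA addnA.
  by congr (_ + _); apply: eq_bigr => u /andP[_ /negPf up]; rewrite /c' up.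
have [|h [hP hN]] := QA c'; first by rewrite sumc'.
(* Of the [N] copies of the new edge, the first [c x] point to [p], which the raised demand [c' p]
   has paid for. The other [N - c x] point to [x] and, with its demand, make exactly [N]. *)
pose h' e (j : 'I_N) := if e == e0 then if j < c x then p else x else h e j.
have split_sum u : \sum_(e in E | e \subset x |: A) #|[pred j | h' e j == u]| =
    #|[pred j | h' e0 j == u]| +
    \sum_(e in E | e \subset A) #|[pred j | h e j == u]|.
  rewrite (bigD1 e0) /=; last by rewrite e0E new_edge // eqxx orbT.
  congr (_ + _); apply: eq_big => [e|e /andP[_ /negPf ee0]]; last first.
    by apply: eq_card => j; rewrite !inE /h' ee0.
  case: (boolP (e \in E)) => //= eE; rewrite new_edge //.
  by case: eqP => [->|_]; rewrite ?(negPf e0A) ?orbF ?andbT ?andbF.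
exists h'; split=> [e j eE|u].
  rewrite new_edge // /h'; case: eqP => [-> _|_]; last by rewrite orbF; apply: hP.
  by case: ifP; rewrite !inE eqxx ?orbT.
rewrite split_sum !inE; have [->|ux] := eqVneq u x => /= [_|uA].
  rewrite big1 => [|e /andP[eE eA]]; last first.
    apply: eq_card0 => j; rewrite !inE; apply: contraNF xA => /eqP<-.
    by apply: (subsetP eA); apply: hP.
  rewrite (@eq_card _ _ [pred j : 'I_N | ~~ (j < c x)]) => [|j].
    by rewrite card_ord_geq addn0 subnK.
  rewrite !inE /h' eqxx; case: ifP => _; last by rewrite eqxx.
  by rewrite eq_sym (negPf px_neq).
have := hN u uA; rewrite /c'; case: (eqVneq u p) => [->|up].
  rewrite (@eq_card _ _ [pred j : 'I_N | j < c x]) => [|j].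
    by rewrite card_ord_lt (minn_idPl cN) -addnA [c x + _]addnC -addnA.
  by rewrite !inE /h' eqxx; case: ifP => _; rewrite ?eqxx // (negPf px_neq).
rewrite (eq_card0 (A := [pred j | h' e0 j == u])) // => j.
by rewrite !inE /h' eqxx; case: ifP => _; rewrite eq_sym; apply: negbTE.
Qed.

(** * Ranking the vertices of each base clique *)

(* [key] refines the distance to the next hyperedge with the same label; the index of
   the vertex breaks ties, which occur only at distance [n], i.e. for labels of degree 1. *)
Lemma clique_ranking (V : finType) (n : nat) (H : {set {set V}})
    (F : 'I_n -> {set V}) (lab : G1vertex n -> V) :
  linear_hypergraph H -> injective F -> H = [set F i | i : 'I_n] ->
  labelling F lab ->
  exists key : G1vertex n -> nat,
    (forall i, {in base_clique i &, injective key}) /\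
    (forall v, \sum_(x | lab x == v)
       #|[set y : G1vertex n | (y.1 == x.1) && (key y < key x)]|.+1 <= n).
Proof.
move=> linH injF HE labF.
pose D v := [set i | v \in F i].
have [g gP] := fin_all_exists (fun v => cyclic_gaps (D v)).
pose gap x := g (lab x) x.1.
have labD x : x.1 \in D (lab x).
  by rewrite inE; case: (labF x.1) => _ <-; rewrite imset_f ?inE.
have gapP x := (gP (lab x)).1 x.1 (labD x).
have inj_lab x y : x.1 = y.1 -> lab x = lab y -> x = y.
  by move=> xy; apply: (labF x.1).1; rewrite inE ?xy.
(* Equal gaps below [n] put both labels in the same two distinct hyperedges, which by linearity
   share at most one vertex. *)
have gap_inj x y : x.1 = y.1 -> gap x < n -> gap x = gap y -> x = y.
  move=> xy ltn gxy; apply: inj_lab => //.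
  have [/andP[gt0 _] [j]] := gapP x; rewrite inE => xj jE.
  have [_ [j']] := gapP y; rewrite inE => yj j'E.
  have jj' : j' = j by apply: val_inj; rewrite /= j'E jE -/(gap y) -gxy -xy.
  (* Returning to the same index would make the gap divisible by [n], but it lies strictly between
     [0] and [n]. *)
  have ji : F x.1 != F j.
    apply: contraTneq gt0 => /injF ij; rewrite -leqNgt -/(gap x).
    move/(congr1 (fun k => k %% n)): jE; rewrite -ij modn_mod.
    rewrite -[in LHS](addn0 x.1) => /eqP; rewrite eqn_modDl -/(gap x).
    by rewrite mod0n modn_small // => /eqP<-.
  have FH i : F i \in H by rewrite HE imset_f.
  have := linH _ _ (FH _) (FH _) ji => /card_le1_eqP; apply.
    by rewrite inE -jj' yj xy; have := labD y; rewrite inE => ->.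
  by rewrite inE xj; have := labD x; rewrite inE => ->.
(* Lexicographic order: since [x.2 < n], the gap dominates and the position in the clique breaks
   ties. *)
pose key (x : G1vertex n) := gap x * n + x.2.
have key_gap x y : key y <= key x -> gap y <= gap x.
  rewrite /key; have := ltn_ord x.2; case: (leqP (gap y) (gap x)) => //.
  by move=> /(leq_mul (leqnn n)); rewrite ![n * _]mulnC mulSn; lia.
have key_inj i : {in base_clique i &, injective key}.
  move=> [a x] [b y]; rewrite !inE /= => /eqP-> /eqP-> kxy; congr pair.
  have gxy : gap (i, x) = gap (i, y).
    by apply/anti_leq/andP; split; apply: key_gap; rewrite kxy.
  by move: kxy; rewrite /key gxy => /addnI/val_inj.
exists key; split=> // v.
have rank_gap x :
    #|[set y : G1vertex n | (y.1 == x.1) && (key y < key x)]|.+1 <= gap x.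
  set B := [set y | _]; have xB : x \notin B by rewrite inE ltnn andbF.
  suff : #|x |: B| <= gap x by rewrite cardsU1 xB.
  have BP y : y \in x |: B -> y.1 = x.1 /\ gap y <= gap x.
    rewrite !inE => /predU1P[->//|/andP[/eqP-> /ltnW/key_gap]//].
  (* At gap [n] the size of the clique suffices as a bound. Below [n], the gaps of the vertices in
     [x |: B] are distinct numbers in [1, ..., gap x]. *)
  have /andP[_] := (gapP x).1; rewrite leq_eqVlt => /orP[/eqP gx|gx].
    rewrite -/(gap x) in gx; rewrite gx.
    have snd_inj : {in x |: B &, injective (fun y : G1vertex n => y.2)}.
      by move=> [a1 b1] [a2 b2] /BP[/= -> _] /BP[/= -> _] ->.
    by have := leq_card_in _ _ snd_inj; rewrite card_ord.
  rewrite cardE -(size_map gap) -(size_iota 1 (gap x)); apply: uniq_leq_size.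
    rewrite map_inj_in_uniq ?enum_uniq // => y z; rewrite !mem_enum.
    move=> /BP[y1 yg] /BP[z1 _]; apply: gap_inj; first by rewrite y1 z1.
    exact: leq_ltn_trans gx.
  move=> _ /mapP[y + ->]; rewrite mem_enum mem_iota => /BP[_ yg].
  by have /andP[-> _] := (gapP y).1; rewrite add1n ltnS.
apply: leq_trans _ (gP v).2.
apply: (@leq_trans (\sum_(x | lab x == v) gap x)).
  by apply: leq_sum => x _; apply: rank_gap.
(* A label occurs at most once per clique, so the sum over its vertices is dominated by the sum over
   the hyperedges containing it. *)
have fst_inj : {in [set x | lab x == v] &, injective (fun x : G1vertex n => x.1)}.
  by move=> x y; rewrite !inE => /eqP xv /eqP yv /inj_lab; apply; rewrite xv yv.
rewrite (eq_bigl (mem [set x | lab x == v])) => [|x]; last by rewrite /= inE.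
rewrite (eq_bigr (fun x => g v x.1)) => [|x]; last first.
  by rewrite /= inE => /eqP xv; rewrite /gap xv.
rewrite -(big_imset (g v) fst_inj) /= big_mkcond [leqRHS]big_mkcond /=.
apply: leq_sum => i _; case: ifP => // /imsetP[x]; rewrite inE => /eqP xv ->.
by rewrite -xv labD.
Qed.

(** * Assembling the orientation and bounding in-degrees *)

Theorem mainTheorem1 (V : finType) (n : nat) (H : {set {set V}})
    (F : 'I_n -> {set V}) (lab : G1vertex n -> V)
    (T : V -> {set {set G1vertex n}}) :
  1 <= n ->
  uniform_hypergraph n H ->
  linear_hypergraph H ->
  injective F ->
  H = [set F i | i : 'I_n] ->
  labelling F lab ->
  identifier_trees lab T ->
  exists oI : identifier_edge T -> G1vertex n,
    identifier_orientation oI /\ Vandermonde_completable oI.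
Proof.
move=> n_gt0 _ linH injF HE labF treeT.
have [key [key_inj key_sum]] := clique_ranking linH injF HE labF.
pose b (x : G1vertex n) := #|[set y : G1vertex n | (y.1 == x.1) && (key y < key x)]|.
(* A label that occurs has a successor term in [key_sum]; dropping one successor lowers the bound
   [n] to [n.-1], the number of copies of each tree edge. *)
have b_sum v : \sum_(x in [set x | lab x == v]) b x <= n.-1.
  have [->|[x]] := set_0Vmem [set x | lab x == v]; first by rewrite big_set0.
  rewrite inE => xv.
  rewrite (eq_bigl (fun y => lab y == v)) => [|y]; last by rewrite inE.
  rewrite -ltnS prednK //; apply: leq_trans (key_sum v).
  rewrite (bigD1 x) // [leqRHS](bigD1 x) //= -addSn leq_add2l.
  by apply: leq_sum.
pose x0 : G1vertex n := (Ordinal n_gt0, Ordinal n_gt0).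
have [h hP] := fin_all_exists (fun v =>
  spanning_tree_orientation x0 (treeT v) (b_sum v)).
pose oI (p : identifier_edge T) := h (val p).1.1 (val p).1.2 (val p).2.
have oIP : identifier_orientation oI.
  by move=> p; apply: (hP _).1; apply: valP p.
(* Each base edge points to its end of larger key, so [b x] counts the possible tails of base edges
   with head [x]. *)
have baseP (e : base_edge n) : exists x : G1vertex n,
    x \in val e /\ {in val e, forall y, key y <= key x}.
  have /andP[/eqP e2 _] := valP e.
  have /set0Pn[y ye] : val e != set0 by rewrite -card_gt0 e2.
  by case: (arg_maxnP key ye) => x xe xmax; exists x.
have [oB oBP] := fin_all_exists baseP.
pose o (e : medge (G1 T)) : mvertex (G1 T) :=
  match e with inl e => oB e | inr p => oI p end.
have base_pair x y (e : base_edge n) : val e = [set x; y] -> x.1 = y.1 /\ x != y.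
  move=> eE; have := valP e; rewrite eE cards2 => /andP[/eqP e2].
  move=> /existsP[i /subsetP ei]; split; last by case: eqP e2.
  have := ei x; have := ei y; rewrite !inE !eqxx orbT => /(_ isT)/eqP-> /(_ isT)/eqP->.
  by [].
have oB_key x y (e : base_edge n) : val e = [set x; y] -> (oB e == y) = (key x < key y).
  move=> eE; have [xy1 xy] := base_pair _ _ _ eE; have [oe omax] := oBP e.
  have xe : key x <= key (oB e) by apply: omax; rewrite eE !inE eqxx.
  have ye : key y <= key (oB e) by apply: omax; rewrite eE !inE eqxx orbT.
  apply/eqP/idP => [oy|ltxy].
    rewrite ltn_neqAle -oy xe andbT; apply: contraNneq xy => kxy.
    by apply/eqP; apply: (key_inj y.1); rewrite ?inE ?xy1 // kxy oy.
  move: oe; rewrite eE !inE => /orP[/eqP ox|/eqP//].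
  by move: ye; rewrite ox leqNgt ltxy.
have arcE x y : x.1 = y.1 -> base_arc o x y = (key x < key y).
  move=> xy1; apply/existsP/idP => [[e /andP[/eqP eE]]|ltxy].
    by rewrite /= (oB_key _ _ _ eE).
  pose P (e : {set G1vertex n}) := (#|e| == 2) && [exists i, e \subset base_clique i].
  have eP : P [set x; y].
    have xy : x != y by apply: contraTneq ltxy => ->; rewrite ltnn.
    rewrite /P cards2 xy /=; apply/existsP; exists y.1; apply/subsetP=> z.
    by rewrite !inE => /orP[]/eqP->; rewrite ?xy1.
  by exists (exist P _ eP); rewrite /= eqxx (oB_key x).
exists oI; split=> //; exists o; split=> //.
- by case=> [e|p]; [case: (oBP e)|apply: oIP].
- move=> i; split=> [x|x y|x y z]; rewrite ?inE.
  + by move=> _; rewrite arcE // ltnn.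
  + move=> /eqP xi /eqP yi xy; rewrite !arcE ?xi ?yi //.
    case: ltngtP => // kxy; case/eqP: xy.
    by apply: (key_inj i); rewrite ?inE ?xi ?yi.
  + move=> /eqP xi /eqP yi /eqP zi; rewrite !arcE ?xi ?yi ?zi //.
    exact: ltn_trans.
move=> x; rewrite /indegree subn1.
set A := [set e : base_edge n | oB e == x].
set B := [set p : identifier_edge T | oI p == x].
have -> : [set e | o e == x] = [set inl e | e in A] :|: [set inr p | p in B].
  apply/setP=> -[e|p]; rewrite !inE /=.
    rewrite mem_imset ?inE; last by move=> ? ? [].
    by rewrite orbC; case: imsetP => // -[].
  rewrite [X in _ || X]mem_imset ?inE; last by move=> ? ? [].
  by case: imsetP => // -[].
apply: leq_trans (leq_card_setU _ _) _.
rewrite !card_imset; try by move=> ? ? [].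
have Ab : #|A| <= b x.
  rewrite -(card_imset _ val_inj).
  apply: leq_trans (leq_imset_card (fun y => [set y; x]) _).
  apply/subset_leq_card/subsetP => _ /imsetP[e eA ->].
  have ox : oB e = x by apply/eqP; rewrite inE in eA.
  have /andP[/eqP e2 _] := valP e; have := (oBP e).1; rewrite ox => xe.
  have [y _ eE] := cards2_mem e2 xe; rewrite eE.
  apply: (imset_f (fun y => [set y; x])); rewrite inE.
  by rewrite (base_pair _ _ _ eE).1 eqxx -(oB_key _ _ _ eE) ox eqxx.
(* An identifier edge with head [x] must come from the tree of the label of [x], because a tree only
   touches vertices carrying its own label. *)
have BS : #|B| <= \sum_(e in T (lab x)) #|[pred k | h (lab x) e k == x]|.
  have Blab p : p \in B -> (val p).1.1 = lab x.
    rewrite inE => /eqP px; have [eP _ _] := treeT (val p).1.1.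
    have [_ /subsetP/(_ x)] := eP _ (valP p); rewrite inE => sub.
    by apply/esym/eqP/sub; rewrite -px; apply: oIP.
  pose f (p : identifier_edge T) := ((val p).1.2, (val p).2).
  have f_inj : {in B &, injective f}.
    move=> p q /Blab pl /Blab ql [pq1 pq2]; apply: val_inj.
    apply: injective_projections => //.
    by apply: injective_projections => //; apply: (etrans pl).
  rewrite -(card_in_imset f_inj).
  rewrite -(card_pairs_dep (mem (T (lab x))) (fun e k => h (lab x) e k == x)).
  apply/subset_leq_card/subsetP => _ /imsetP[p pB ->]; rewrite inE /=.
  by rewrite -(Blab p pB) (valP p); rewrite inE in pB.
apply: leq_trans ((hP (lab x)).2 x _); last by rewrite inE.
by rewrite addnC leq_add.
Qed.
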